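(* Let $K$ be a bounded right linear operator with closed range on a separable right quaternionic Hilbert space $\mathbb{H}(\mathfrak{H})$. Let $F=\{f_k\}_{k\in I}$ be a $K$-frame for $\mathbb{H}(\mathfrak{H})$, let $P_{R(K)}$ be the orthogonal projection onto the range of $K$, and let $G=\{g_k\}_{k\in I}$ be a $K$-dual of $\{P_{R(K)}f_k\}_{k\in I}$. If $\|T_FT_G^*\|<1$, then $\{g_k\}_{k\in I}$ is an approximate $K$-dual of $\{f_k\}_{k\in I}$.
   Context: $\mathfrak{H}$ denotes the quaternions. A right quaternionic Hilbert space $\mathbb{H}(\mathfrak{H})$ is a right $\mathfrak{H}$-vector space with an inner product $\langle\cdot,\cdot\rangle$ valued in $\mathfrak{H}$ that satisfies $\overline{\langle x,y\rangle}=\langle y,x\rangle$, $\langle x,x\rangle>0$ for $x\neq0$, additivity in the second argument, and $\langle x,yq\rangle=\langle x,y\rangle q$ for $q\in\mathfrak{H}$, and it is complete for $\|x\|=\sqrt{\langle x,x\rangle}$. $I$ is a countable index set. $\ell^2(\mathfrak{H})$ is the right quaternionic Hilbert space of square-summable families $\{q_k\}_{k\in I}\subset\mathfrak{H}$ with $\langle p,q\rangle=\sum_{k}\overline{p_k}q_k$. All operators are bounded and right linear ($T(xp+yq)=T(x)p+T(y)q$), and $T^*$ is the adjoint. A family $\{f_k\}_{k\in I}\subset\mathbb{H}(\mathfrak{H})$ is a Bessel sequence if there is $B>0$ with $\sum_{k}|\langle x,f_k\rangle|^2\le B\|x\|^2$ for all $x$. It is a $K$-frame if there are $A,B>0$ with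 $A\|K^*x\|^2\le\sum_{k}|\langle x,f_k\rangle|^2\le B\|x\|^2$ for all $x$. A Bessel sequence $\{g_k\}_{k\in I}$ is a $K$-dual of a $K$-frame $\{f_k\}_{k\in I}$ if $Kx=\sum_{k\in I}f_k\langle g_k,x\rangle$ for all $x\in\mathbb{H}(\mathfrak{H})$. The synthesis operator of a Bessel sequence $F=\{f_k\}$ is $T_F:\ell^2(\mathfrak{H})\to\mathbb{H}(\mathfrak{H})$, $T_F(\{c_k\})=\sum_kf_kc_k$, with adjoint $T_F^*x=\{\langle f_k,x\rangle\}_{k}$. A Bessel sequence $G=\{g_k\}_{k\in I}$ is an approximate $K$-dual of a $K$-frame $F=\{f_k\}_{k\in I}$ if $\|K-T_FT_G^*\|<1$. *)

(* Defs.v *)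
From HB Require Import structures.
From mathcomp Require Import all_boot all_order all_algebra finmap.
From mathcomp Require Import all_classical all_reals.
From mathcomp Require Import ereal topology normedtype esum ring lra.
From mathcomp.analysis.showcase Require summability.

Set Implicit Arguments.
Unset Strict Implicit.
Unset Printing Implicit Defensive.

Import Order.TTheory GRing.Theory Num.Theory.
Import numFieldNormedType.Exports.

Local Open Scope classical_set_scope.
Local Open Scope ring_scope.

Section discriminant.
Variable R : realType.
Implicit Types a b c : R.

Lemma discriminant_le a b c : 0 <= a ->
  (forall t, 0 <= a * t ^+ 2 + 2 * b * t + c) -> b ^+ 2 <= a * c.
Proof.
move=> a0 H; have [a_eq0|a_neq0] := eqVneq a 0.
  have [->|b0] := eqVneq b 0; first by rewrite a_eq0 expr0n mul0r.
  have := H (- (c + 1) / (2 * b)).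
  have -> : a * (- (c + 1) / (2 * b)) ^+ 2 + 2 * b * (- (c + 1) / (2 * b)) + c
    = - 1 by rewrite a_eq0; field.
  by rewrite ler0N1.
have a_gt0 : 0 < a by rewrite lt_neqAle eq_sym a_neq0.
have := H (- b / a).
have -> : a * (- b / a) ^+ 2 + 2 * b * (- b / a) + c = (a * c - b ^+ 2) / a.
  by field.
by rewrite pmulr_lge0 ?invr_gt0// subr_ge0.
Qed.

Lemma sqrt_triangle a b c : 0 <= a -> 0 <= c -> b ^+ 2 <= a * c ->
  Num.sqrt (a + 2 * b + c) <= Num.sqrt a + Num.sqrt c.
Proof.
move=> a0 c0 hb; rewrite -[leRHS]ger0_norm ?addr_ge0 ?sqrtr_ge0// -sqrtr_sqr.
rewrite ler_wsqrtr// sqrrD !sqr_sqrtr// lerD2r lerD2l -[leRHS]mulr_natl.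
rewrite ler_wpM2l// -sqrtrM// (le_trans (ler_norm b))// -sqrtr_sqr.
exact: ler_wsqrtr.
Qed.

End discriminant.

(* Quat a b c d is a + b i + c j + d k *)
Record quat (R : Type) := Quat { qre : R ; qi : R ; qj : R ; qk : R }.
Arguments Quat {R} _ _ _ _.
Arguments qre {R} _.
Arguments qi {R} _.
Arguments qj {R} _.
Arguments qk {R} _.

Section quat_choice.
Variable R : choiceType.

Definition quat_tuple (p : quat R) := (qre p, qi p, qj p, qk p).
Definition tuple_quat (x : R * R * R * R) :=
  Quat x.1.1.1 x.1.1.2 x.1.2 x.2.

Lemma quat_tupleK : cancel quat_tuple tuple_quat. Proof. by case. Qed.

HB.instance Definition _ := Choice.copy (quat R) (can_type quat_tupleK).

End quat_choice.

Section quat_ring.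
Variable R : realType.
Implicit Types p q r : quat R.

Definition qzero : quat R := Quat 0 0 0 0.
Definition qone : quat R := Quat 1 0 0 0.
Definition qopp p : quat R := Quat (- qre p) (- qi p) (- qj p) (- qk p).
Definition qadd p q : quat R :=
  Quat (qre p + qre q) (qi p + qi q) (qj p + qj q) (qk p + qk q).
Definition qmul p q : quat R := Quat
  (qre p * qre q - qi p * qi q - qj p * qj q - qk p * qk q)
  (qre p * qi q + qi p * qre q + qj p * qk q - qk p * qj q)
  (qre p * qj q - qi p * qk q + qj p * qre q + qk p * qi q)
  (qre p * qk q + qi p * qj q - qj p * qi q + qk p * qre q).

Ltac quat_ring := repeat case=> ? ? ? ?; rewrite /qmul /qadd /=; congr Quat; ring.

Lemma qaddA : associative qadd. Proof. quat_ring. Qed.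
Lemma qaddC : commutative qadd. Proof. quat_ring. Qed.
Lemma qadd0 : left_id qzero qadd. Proof. quat_ring. Qed.
Lemma qaddN : left_inverse qzero qopp qadd. Proof. quat_ring. Qed.

HB.instance Definition _ := GRing.isZmodule.Build (quat R) qaddA qaddC qadd0 qaddN.

Lemma qmulA : associative qmul. Proof. quat_ring. Qed.
Lemma qmul1 : left_id qone qmul. Proof. quat_ring. Qed.
Lemma q1mul : right_id qone qmul. Proof. quat_ring. Qed.
Lemma qmulDl : left_distributive qmul qadd. Proof. quat_ring. Qed.
Lemma qmulDr : right_distributive qmul qadd. Proof. quat_ring. Qed.
Lemma qone_neq0 : qone != 0 :> quat R.
Proof. by apply/eqP => -[] /eqP; rewrite oner_eq0. Qed.

HB.instance Definition _ := GRing.Zmodule_isNzRing.Build (quat R)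
  qmulA qmul1 q1mul qmulDl qmulDr qone_neq0.

Definition qconj p : quat R := Quat (qre p) (- qi p) (- qj p) (- qk p).

Definition qreal (t : R) : quat R := Quat t 0 0 0.

Lemma qrealD t u : qreal (t + u) = qreal t + qreal u.
Proof. by rewrite -[RHS]/(qadd _ _) /qadd/= !addr0. Qed.

Lemma qrealM t u : qreal (t * u) = qreal t * qreal u.
Proof. by rewrite -[RHS]/(qmul _ _) /qmul/=; congr Quat; ring. Qed.

Lemma qre_mulqreal p t : qre (p * qreal t) = t * qre p.
Proof. by rewrite -[p * _]/(qmul _ _) /qmul/=; ring. Qed.

Lemma qconjD p q : qconj (p + q) = qconj p + qconj q.
Proof. by congr Quat; rewrite opprD. Qed.

Lemma qconjM p q : qconj (p * q) = qconj q * qconj p.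
Proof.
by rewrite -[p * q]/(qmul _ _) -[RHS]/(qmul _ _) /qmul/qconj/=; congr Quat; ring.
Qed.

Lemma qconjK : involutive qconj.
Proof. by case=> a b c d; rewrite /qconj/= !opprK. Qed.

Lemma qre_conjM p :
  qre (qconj p * p) = qre p ^+ 2 + qi p ^+ 2 + qj p ^+ 2 + qk p ^+ 2.
Proof. by rewrite -[_ * p]/(qmul _ _) /qmul/=; ring. Qed.

End quat_ring.

Reserved Notation "x *q a" (at level 40, left associativity).

HB.mixin Record Zmodule_isRQModule (R : realType) V & GRing.Zmodule V := {
  rscale : V -> quat R -> V ;
  rscaleA : forall x (p q : quat R), rscale x (p * q) = rscale (rscale x p) q ;
  rscaler1 : forall x, rscale x 1 = x ;
  rscaleDl : forall x y (p : quat R), rscale (x + y) p = rscale x p + rscale y p ;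
  rscaleDr : forall x (p q : quat R), rscale x (p + q) = rscale x p + rscale x q
}.

#[short(type="rqModType")]
HB.structure Definition RQModule (R : realType) :=
  {V of GRing.Zmodule V & Zmodule_isRQModule R V}.

Notation "x *q a" := (rscale x a) : ring_scope.

(* A right quaternionic space is also a real one, by restriction of scalars;
   this gives access to the library of normed modules.
   [qre (qdot x x)] is all of [qdot x x], by [qdotC]. *)
HB.mixin Record NormedModule_isRQPreHilbert (R : realType) V
    & NormedModule R V & RQModule R V := {
  scale_rscale : forall (t : R) (x : V), t *: x = x *q qreal t ;
  qdot : V -> V -> quat R ;
  qdotC : forall x y, qconj (qdot x y) = qdot y x ;
  qdot_gt0 : forall x, x != 0 -> 0 < qre (qdot x x) ;
  qdotDr : forall x y z, qdot x (y + z) = qdot x y + qdot x z ;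
  qdotZr : forall x y (a : quat R), qdot x (y *q a) = qdot x y * a ;
  norm_qdot : forall x, `|x| = Num.sqrt (qre (qdot x x))
}.

#[short(type="rqPreHilbertType")]
HB.structure Definition RQPreHilbert (R : realType) :=
  {V of NormedModule R V & RQModule R V & NormedModule_isRQPreHilbert R V}.

#[short(type="rqHilbertType")]
HB.structure Definition RQHilbert (R : realType) :=
  {V of RQPreHilbert R V & Complete V}.

(* Any right quaternionic space with an inner product is such a structure,
   with the real scaling, norm and topology derived from the inner product. *)
HB.factory Record RQModule_isRQPreHilbert (R : realType) V
    & RQModule R V := {
  qdot : V -> V -> quat R ;
  qdotC : forall x y, qconj (qdot x y) = qdot y x ;
  qdot_gt0 : forall x, x != 0 -> 0 < qre (qdot x x) ;
  qdotDr : forall x y z, qdot x (y + z) = qdot x y + qdot x z ;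
  qdotZr : forall x y (a : quat R), qdot x (y *q a) = qdot x y * a
}.

HB.builders Context R V & RQModule_isRQPreHilbert R V.

Let rdot x y : R := qre (qdot x y).

Let rdotC x y : rdot x y = rdot y x.
Proof. by rewrite /rdot -qdotC. Qed.

Let rdotDr x y z : rdot x (y + z) = rdot x y + rdot x z.
Proof. by rewrite /rdot qdotDr. Qed.

Let rdotDl x y z : rdot (x + y) z = rdot x z + rdot y z.
Proof. by rewrite rdotC rdotDr !(rdotC z). Qed.

Let rdot0r x : rdot x 0 = 0.
Proof. by apply: (addrI (rdot x 0)); rewrite -rdotDr !addr0. Qed.

Let rdotZr x y (t : R) : rdot x (y *q qreal t) = t * rdot x y.
Proof. by rewrite /rdot qdotZr qre_mulqreal. Qed.

Let rdotZl x y (t : R) : rdot (x *q qreal t) y = t * rdot x y.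
Proof. by rewrite rdotC rdotZr rdotC. Qed.

Let rdot_ge0 x : 0 <= rdot x x.
Proof.
by have [->|/qdot_gt0/ltW//] := eqVneq x 0; rewrite rdot0r.
Qed.

Let norm x := Num.sqrt (rdot x x).

Let ler_normD x y : norm (x + y) <= norm x + norm y.
Proof.
rewrite /norm rdotDr !rdotDl (rdotC y) addrA -[_ + _ + rdot x y]addrA -mulr2n.
rewrite -mulr_natl; apply: sqrt_triangle => //; rewrite mulrC.
apply: discriminant_le => // t.
have := rdot_ge0 (x + y *q qreal t).
rewrite rdotDr !rdotDl !rdotZl !rdotZr (rdotC y x) => h.
by apply: le_trans h _; rewrite le_eqVlt; apply/orP; left; apply/eqP; ring.
Qed.

Let norm0_eq0 x : norm x = 0 -> x = 0.
Proof.
move=> /eqP; rewrite sqrtr_eq0; apply: contraTeq => /qdot_gt0.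
by rewrite -ltNge.
Qed.

Let scale (t : R) (x : V) : V := x *q qreal t.

Let scaleA a b x : scale a (scale b x) = scale (a * b) x.
Proof. by rewrite /scale -rscaleA -qrealM mulrC. Qed.

Let scale1 : left_id 1 scale. Proof. exact: rscaler1. Qed.

Let scaleDr : right_distributive scale +%R.
Proof. by move=> a x y; exact: rscaleDl. Qed.

Let scaleDl x : {morph scale^~ x : a b / a + b}.
Proof. by move=> a b; rewrite /scale qrealD rscaleDr. Qed.

HB.instance Definition _ :=
  GRing.Zmodule_isLmodule.Build R V scaleA scale1 scaleDr scaleDl.

Let normZ (t : R) x : norm (t *: x) = `|t| * norm x.
Proof.
rewrite /norm -[t *: x]/(scale t x) /scale rdotZl rdotZr mulrA -expr2.
rewrite sqrtrM ?sqr_ge0//.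
by rewrite sqrtr_sqr.
Qed.

HB.instance Definition _ :=
  Lmodule_isNormed.Build R V ler_normD normZ norm0_eq0.
HB.instance Definition _ := NormedModule_isRQPreHilbert.Build R V
  (fun _ _ => erefl) qdotC qdot_gt0 qdotDr qdotZr (fun=> erefl).

HB.end.

Lemma cauchy_nonexpansive (R : realType) (U V : normedModType R) (f : U -> V)
    (F : set_system U) {FF : Filter F} : (forall x y, `|f x - f y| <= `|x - y|) ->
  cauchy F -> cauchy (f @ F).
Proof.
move=> fle /cauchy_ballP Fc; apply/cauchy_ballP => e e0.
have [[A B] [/= FA FB] AB] := Fc e e0.
exists (f @` A, f @` B) => /=.
  split; first by apply: filterS FA => x Ax; exists x.
  by apply: filterS FB => x Bx; exists x.
move=> [a b] [[x Ax] /= <- [y By] /= <-].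
have := AB (x, y) (conj Ax By); rewrite -!ball_normE /=.
exact: le_lt_trans (fle x y).
Qed.

Section quat_hilbert.
Variable R : realType.
Implicit Types p q : quat R.

HB.instance Definition _ := Zmodule_isRQModule.Build R (quat R)
  (@mulrA _) (@mulr1 _) (@mulrDl _) (@mulrDr _).

Let dot p q : quat R := qconj p * q.

Let dotC p q : qconj (dot p q) = dot q p.
Proof. by rewrite /dot qconjM qconjK. Qed.

Let dot_gt0 p : p != 0 -> 0 < qre (dot p p).
Proof.
move=> p0; rewrite /dot qre_conjM lt_neqAle !addr_ge0 ?sqr_ge0// andbT.
apply: contra p0; rewrite eq_sym !paddr_eq0 ?addr_ge0 ?sqr_ge0// !sqrf_eq0.
by case: p => a b c d /= /andP[/andP[/andP[/eqP-> /eqP->] /eqP->] /eqP->].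
Qed.

Let dotDr p q r : dot p (q + r) = dot p q + dot p r.
Proof. exact: mulrDr. Qed.

Let dotZr p q r : dot p (q *q r) = dot p q * r.
Proof. exact: mulrA. Qed.

HB.instance Definition _ := RQModule_isRQPreHilbert.Build R (quat R)
  dotC dot_gt0 dotDr dotZr.

Lemma normqE p :
  `|p| = Num.sqrt (qre p ^+ 2 + qi p ^+ 2 + qj p ^+ 2 + qk p ^+ 2).
Proof. by rewrite norm_qdot -[qdot _ _]/(qconj p * p) qre_conjM. Qed.

Lemma sqr_normq p :
  `|p| ^+ 2 = qre p ^+ 2 + qi p ^+ 2 + qj p ^+ 2 + qk p ^+ 2.
Proof. by rewrite normqE sqr_sqrtr// !addr_ge0 ?sqr_ge0. Qed.

Lemma normqM p q : `|p * q| = `|p| * `|q|.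
Proof.
apply: (pexpIrn (n := 2)); rewrite ?nnegrE ?mulr_ge0//.
rewrite exprMn !sqr_normq -[p * q]/(qmul p q) /qmul /=; ring.
Qed.

Lemma normq_conj p : `|qconj p| = `|p|.
Proof. by rewrite !normqE /= !sqrrN. Qed.

Lemma quat_comp_le p :
  [/\ `|qre p| <= `|p|, `|qi p| <= `|p|, `|qj p| <= `|p| & `|qk p| <= `|p|].
Proof.
have [a2 b2 c2 d2] : [/\ 0 <= qre p ^+ 2, 0 <= qi p ^+ 2, 0 <= qj p ^+ 2 &
  0 <= qk p ^+ 2] by rewrite !sqr_ge0.
by rewrite normqE -!sqrtr_sqr; split; apply: ler_wsqrtr; lra.
Qed.

Lemma quat_basis p : p =
  qre p *: Quat 1 0 0 0 + qi p *: Quat 0 1 0 0 +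
  qj p *: Quat 0 0 1 0 + qk p *: Quat 0 0 0 1.
Proof.
rewrite !scale_rscale; case: p => a b c d.
rewrite -[RHS]/(qadd (qadd (qadd (qmul _ _) (qmul _ _)) (qmul _ _)) (qmul _ _)).
by rewrite /qadd /qmul /=; congr Quat; ring.
Qed.

Lemma quat_complete (F : set_system (quat R)) :
  ProperFilter F -> cauchy F -> cvg F.
Proof.
move=> FF Fc.
have key (f : quat R -> R) : (forall p q, f (p - q) = f p - f q) ->
    (forall p, `|f p| <= `|p|) -> cvg (f @ F).
  move=> fB fle; apply: cauchy_cvg; apply: cauchy_nonexpansive => // p q.
  by rewrite -fB.
pose l := lim (qre @ F) *: Quat 1 0 0 0 + lim (qi @ F) *: Quat 0 1 0 0 +
  lim (qj @ F) *: Quat 0 0 1 0 + lim (qk @ F) *: Quat 0 0 0 1 : quat R.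
apply/cvg_ex; exists l.
rewrite -[F]/(id @ F) (funext quat_basis : id = _).
by do !apply: cvgD; apply: cvgZr_tmp; apply: key => // p;
  case: (quat_comp_le p).
Qed.

HB.instance Definition _ := Uniform_isComplete.Build (quat R) quat_complete.

End quat_hilbert.

Notation partial_sum := summability.partial_sum.
Notation totally := summability.totally.
#[global] Existing Instance summability.totally_filter.

(* Sum of a family over an index set with no preferred order: the limit of the
   finite partial sums along the finite subsets of [I]. *)
Notation family_sum := summability.sum.

Section families.
Variables (R : realType) (I : choiceType).

Lemma partial_sumE (V : zmodType) (x : I -> V) (J : {fset I}) :
  partial_sum x J = \sum_(i <- J) x i.
Proof. by rewrite /partial_sum big_seq_fsetE. Qed.

Lemma totally_ge (J : {fset I}) : \forall K \near totally, (J `<=` K)%fset.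
Proof. by exists J. Qed.

Lemma partial_sum_split (V : zmodType) (x : I -> V) (J K : {fset I}) :
  (J `<=` K)%fset -> partial_sum x K =
    partial_sum x J + partial_sum x [fset i in K | i \notin J]%fset.
Proof.
move=> JK; rewrite !partial_sumE [LHS](big_fsetID _ (mem J))/=; congr (_ + _).
apply: eq_fbigl => i; rewrite !inE/= andbC.
by case: (boolP (i \in J)) => //= iJ; rewrite (fsubsetP JK).
Qed.

Lemma partial_sum_le (x : I -> R) (J K : {fset I}) :
  (forall i, 0 <= x i) -> (J `<=` K)%fset ->
  partial_sum x J <= partial_sum x K.
Proof.
by move=> x0 JK; rewrite (partial_sum_split x JK) lerDl sumr_ge0.
Qed.

Lemma cvg_family_sum (V : completeNormedModType R) (x : I -> V) (y : I -> R)
    (n : nat) (M : R) : (0 < n)%N -> (forall i, 0 <= y i) ->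
  (forall J, `|partial_sum x J| ^+ n <= partial_sum y J) ->
  (forall J, partial_sum y J <= M) ->
  cvg (partial_sum x @ totally).
Proof.
move=> n0 y0 xy yM; pose S := range (partial_sum y).
have supS : has_sup S.
  split; first by exists (partial_sum y fset0), fset0.
  by exists M => _ [J _ <-].
apply: cauchy_cvg; apply/cauchy_ballP => e e0.
have e2n : 0 < (e / 2) ^+ n by rewrite exprn_gt0// divr_gt0.
have [_ [J _ <-] hJ] := sup_adherent e2n supS.
have key K : (J `<=` K)%fset -> `|partial_sum x K - partial_sum x J| < e / 2.
  move=> JK; rewrite (partial_sum_split x JK) addrAC subrr add0r.
  rewrite -(@ltr_pXn2r _ n) ?nnegrE ?divr_ge0 ?(ltW e0)//.
  apply: le_lt_trans (xy _) _.
  have : partial_sum y K <= sup S by apply: ub_le_sup; [case: supS|exists K].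
  by rewrite (partial_sum_split _ JK) -lerBrDl; move/le_lt_trans; apply; lra.
exists ([set partial_sum x K | K in [set K | (J `<=` K)%fset]],
        [set partial_sum x K | K in [set K | (J `<=` K)%fset]]) => /=.
  by split; exists J => // K JK; exists K.
move=> [_ _] [/= [K JK <-] [L JL <-]]; rewrite -ball_normE /=.
rewrite -(subrKA (partial_sum x J)) (le_lt_trans (ler_normD _ _))//.
by rewrite [ltRHS]splitr ltrD ?key// distrC key.
Qed.

End families.

Section ell2.
Variables (R : realType) (I : choiceType).

Definition square_summable : {pred I -> quat R} :=
  fun q => (\esum_(k in [set: I]) (`|q k| ^+ 2)%:E < +oo)%E.

Lemma square_summableP (q : I -> quat R) :
  square_summable q <->
  exists M, forall J, partial_sum (fun k => `|q k| ^+ 2) J <= M.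
Proof.
have fsE (J : {fset I}) : (\sum_(k \in [set` J]) (`|q k| ^+ 2)%:E)%E =
    (partial_sum (fun k => `|q k| ^+ 2) J)%:E.
  by rewrite fsbig_finite//= set_fsetK sumEFin partial_sumE.
split=> [q2|[M qM]].
  exists (fine (\esum_(k in [set: I]) (`|q k| ^+ 2)%:E)%E) => J.
  rewrite -lee_fin fineK; last first.
    rewrite ge0_fin_numE//; apply: esum_ge0 => k _.
    by rewrite lee_fin sqr_ge0.
  by rewrite -fsE; apply: ereal_sup_ubound; exists [set` J].
rewrite /square_summable (@le_lt_trans _ _ M%:E) ?ltry//.
apply: ge_ereal_sup => _ [X [finX _] <-].
by rewrite -(fset_setK finX) fsE lee_fin.
Qed.

Lemma square_summable_zmod : zmod_closed square_summable.
Proof.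
split=> [|p q /square_summableP [M pM] /square_summableP [N qN]].
  apply/square_summableP; exists 0 => J.
  by rewrite partial_sumE big1// => k _; rewrite normr0 expr0n.
apply/square_summableP; exists (2 * M + 2 * N) => J.
apply: le_trans (lerD (ler_wpM2l _ (pM J)) (ler_wpM2l _ (qN J))) => //.
rewrite !partial_sumE !mulr_sumr -big_split/=; apply: ler_sum => k _.
have h := ler_normB (p k) (q k).
apply: (@le_trans _ _ ((`|p k| + `|q k|) ^+ 2)).
  by apply: lerXn2r => //; rewrite nnegrE ?addr_ge0.
by have := sqr_ge0 (`|p k| - `|q k|); nra.
Qed.

HB.instance Definition _ :=
  GRing.isZmodClosed.Build (I -> quat R) square_summable square_summable_zmod.

Record ell2 := Ell2 {
  ell2_fun :> I -> quat R ;
  _ : ell2_fun \in square_summable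
}.

HB.instance Definition _ := [isSub for ell2_fun].
HB.instance Definition _ := [Choice of ell2 by <:].
HB.instance Definition _ := [SubChoice_isSubZmodule of ell2 by <:].

End ell2.

Lemma cvg_lipschitz (R : realType) (T : Type) (U V : normedModType R)
    (f : U -> V) (C : R) (F : set_system T) {FF : Filter F} (g : T -> U) (l : U) :
  (forall x y, `|f x - f y| <= C * `|x - y|) ->
  g @ F --> l -> f \o g @ F --> f l.
Proof.
move=> fC /cvgrPdist_lt Fl; apply/cvgrPdist_lt => e e0.
have C1 : 0 < `|C| + 1 by rewrite ltr_wpDl.
apply: filterS (Fl _ (divr_gt0 e0 C1)) => t ht.
apply: le_lt_trans (fC _ _) _.
have := ht; rewrite ltr_pdivlMr// mulrC; apply: le_lt_trans.
by rewrite ler_wpM2r// (le_trans (ler_norm C))// lerDl.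
Qed.

Section ell2_hilbert.
Variables (R : realType) (I : choiceType).
Local Notation ell2 := (ell2 R I).
Implicit Types p q r : ell2.

Lemma ell2_square_summable p : square_summable p.
Proof. by case: p. Qed.

Lemma ell2D p q k : (p + q) k = p k + q k.
Proof. by []. Qed.

Lemma ell2B p q k : (p - q) k = p k - q k.
Proof. by []. Qed.

Lemma square_summable_rscale p (a : quat R) :
  (fun k => p k *q a) \in @square_summable R I.
Proof.
have /square_summableP[M pM] := ell2_square_summable p.
apply/square_summableP; exists (M * `|a| ^+ 2) => J.
apply: le_trans (ler_wpM2r _ (pM J)); rewrite ?sqr_ge0//.
rewrite !partial_sumE mulr_suml; apply: ler_sum => k _.
by rewrite -exprMn -normqM.
Qed.

Definition ell2_rscale p (a : quat R) : ell2 := Ell2 (square_summable_rscale p a).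

Lemma ell2_rscaleA p a b :
  ell2_rscale p (a * b) = ell2_rscale (ell2_rscale p a) b.
Proof. by apply/val_inj/funext => k; exact: mulrA. Qed.

Lemma ell2_rscale1 p : ell2_rscale p 1 = p.
Proof. by apply/val_inj/funext => k; exact: mulr1. Qed.

Lemma ell2_rscaleDl p q a :
  ell2_rscale (p + q) a = ell2_rscale p a + ell2_rscale q a.
Proof. by apply/val_inj/funext => k; exact: mulrDl. Qed.

Lemma ell2_rscaleDr p a b :
  ell2_rscale p (a + b) = ell2_rscale p a + ell2_rscale p b.
Proof. by apply/val_inj/funext => k; exact: mulrDr. Qed.

HB.instance Definition _ := Zmodule_isRQModule.Build R ell2
  ell2_rscaleA ell2_rscale1 ell2_rscaleDl ell2_rscaleDr.

Definition ell2_dot p q : quat R := family_sum (fun k => qconj (p k) * q k).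

Lemma ell2_dot_cvg p q :
  partial_sum (fun k => qconj (p k) * q k) @ totally --> ell2_dot p q.
Proof.
have /square_summableP[M pM] := ell2_square_summable p.
have /square_summableP[N qN] := ell2_square_summable q.
apply: (@cvg_family_sum _ _ (quat R) _ (fun k => `|p k| ^+ 2 + `|q k| ^+ 2)
  1%N (M + N)) => // J.
  rewrite expr1 !partial_sumE; apply: le_trans (ler_norm_sum _ _ _) _.
  apply: ler_sum => k _; rewrite normqM normq_conj.
  by have := sqr_ge0 (`|p k| - `|q k|); have := sqr_ge0 (`|p k| + `|q k|); nra.
by apply: le_trans (lerD (pM J) (qN J)); rewrite !partial_sumE -big_split.
Qed.

Lemma ell2_dot_unique p q (s : quat R) :
  partial_sum (fun k => qconj (p k) * q k) @ totally --> s -> ell2_dot p q = s.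
Proof. exact: norm_cvg_lim. Qed.

Lemma ell2_dotC p q : qconj (ell2_dot p q) = ell2_dot q p.
Proof.
apply/esym/ell2_dot_unique.
have -> : partial_sum (fun k => qconj (q k) * p k) =
    @qconj R \o partial_sum (fun k => qconj (p k) * q k).
  apply/funext => J /=; rewrite !partial_sumE.
  rewrite (big_morph (@qconj R) (@qconjD R) (_ : _ = 0)).
    by apply: eq_bigr => k _; rewrite qconjM qconjK.
  by congr Quat; rewrite oppr0.
apply: (cvg_lipschitz (C := 1)) (@ell2_dot_cvg p q) => x y.
have -> : qconj x - qconj y = qconj (x - y).
  by rewrite qconjD; congr (_ + _); congr Quat.
by rewrite normq_conj mul1r.
Qed.

Lemma ell2_dotDr p q r : ell2_dot p (q + r) = ell2_dot p q + ell2_dot p r.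
Proof.
apply: ell2_dot_unique.
rewrite [X in X @ _ --> _](_ : _ = partial_sum (fun k => qconj (p k) * q k) +
    partial_sum (fun k => qconj (p k) * r k)).
  by apply: cvgD; exact: ell2_dot_cvg.
apply/funext => J /=; rewrite [RHS]/GRing.add/= !partial_sumE -big_split/=.
by apply: eq_bigr => k _; exact: mulrDr.
Qed.

Lemma ell2_dotZr p q (a : quat R) : ell2_dot p (q *q a) = ell2_dot p q * a.
Proof.
apply: ell2_dot_unique.
rewrite [X in X @ _ --> _](_ : _ = (fun z => z * a) \o
    partial_sum (fun k => qconj (p k) * q k)).
  apply: (cvg_lipschitz (C := `|a|)) (@ell2_dot_cvg p q) => x y.
  by rewrite -mulrBl normqM mulrC.
apply/funext => J /=; rewrite !partial_sumE mulr_suml.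
by apply: eq_bigr => k _; rewrite mulrA.
Qed.

Lemma ell2_dot_re_cvg p :
  partial_sum (fun k => `|p k| ^+ 2) @ totally --> qre (ell2_dot p p).
Proof.
rewrite [X in X @ _ --> _](_ : _ = @qre R \o
    partial_sum (fun k => qconj (p k) * p k)).
  apply: (cvg_lipschitz (C := 1) (V := R)) (@ell2_dot_cvg p p) => x y.
  by rewrite mul1r; have [] := quat_comp_le (x - y).
apply/funext => J /=; rewrite !partial_sumE.
rewrite (big_morph (@qre R) (id1 := 0) (op1 := +%R))//.
by apply: eq_bigr => k _; rewrite qre_conjM sqr_normq.
Qed.

Lemma partial_sum_le_ell2_dot p J :
  partial_sum (fun k => `|p k| ^+ 2) J <= qre (ell2_dot p p).
Proof.
apply: (cvgr_to_ge (@ell2_dot_re_cvg p)).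
apply: filterS (totally_ge J) => K; apply: partial_sum_le => k.
exact: sqr_ge0.
Qed.

Lemma ell2_dot_gt0 p : p != 0 -> 0 < qre (ell2_dot p p).
Proof.
move=> p0; have [k pk] : exists k, p k != 0.
  apply: contrapT => /forallNP h; move/eqP: p0; apply.
  by apply/val_inj/funext => k; apply/eqP; have /negP := h k; rewrite negbK.
apply: lt_le_trans (partial_sum_le_ell2_dot p [fset k]%fset).
by rewrite partial_sumE big_seq_fset1 exprn_gt0// normr_gt0.
Qed.

HB.instance Definition _ := RQModule_isRQPreHilbert.Build R ell2
  ell2_dotC ell2_dot_gt0 ell2_dotDr ell2_dotZr.

Lemma sqr_norm_ell2 p : `|p| ^+ 2 = qre (ell2_dot p p).
Proof.
rewrite norm_qdot sqr_sqrtr//; apply: le_trans (partial_sum_le_ell2_dot p fset0).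
by rewrite partial_sumE big_nil.
Qed.

Lemma partial_sum_le_ell2 p J : partial_sum (fun k => `|p k| ^+ 2) J <= `|p| ^+ 2.
Proof. by rewrite sqr_norm_ell2; exact: partial_sum_le_ell2_dot. Qed.

Lemma sqr_norm_ell2_le p M :
  (forall J, partial_sum (fun k => `|p k| ^+ 2) J <= M) -> `|p| ^+ 2 <= M.
Proof.
move=> h; rewrite sqr_norm_ell2; apply: (cvgr_to_le (@ell2_dot_re_cvg p)).
exact: nearW.
Qed.

Lemma norm_ell2_ge p k : `|p k| <= `|p|.
Proof.
rewrite -(@ler_pXn2r _ 2) ?nnegrE//.
have := partial_sum_le_ell2 p [fset k]%fset.
by rewrite partial_sumE big_seq_fset1.
Qed.

Lemma ell2_complete (F : set_system ell2) : ProperFilter F -> cauchy F -> cvg F.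
Proof.
move=> FF Fc; pose ev k p : quat R := p k.
have evc k : ev k @ F --> lim (ev k @ F).
  apply: cauchy_cvg; apply: cauchy_nonexpansive => // p q.
  exact: (norm_ell2_ge (p - q) k).
pose l k := lim (ev k @ F).
have near_l e : 0 < e -> \forall p \near F, forall J : {fset I},
    partial_sum (fun k => `|(p : ell2) k - l k| ^+ 2) J <= e ^+ 2.
  move=> e0; have /cauchy_ballP /(_ e e0) [[A B] [/= FA FB] AB] := Fc.
  apply: filterS FA => p Ap J.
  have pl : (fun q => partial_sum (fun k => `|p k - q k| ^+ 2) J) @ F -->
      partial_sum (fun k => `|p k - l k| ^+ 2) J.
    rewrite partial_sumE; under eq_fun do rewrite partial_sumE.
    apply: cvg_big => [|k _]; first exact: add_continuous.
    rewrite expr2; under eq_fun do rewrite expr2.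
    by apply: cvgM; apply: cvg_norm; apply: cvgB; [exact: cvg_cst|exact: evc|
      exact: cvg_cst|exact: evc].
  apply: (cvgr_to_le pl); apply: filterS FB => q Bq.
  apply: le_trans (partial_sum_le_ell2 (p - q) J) _.
  have := AB (p, q) (conj Ap Bq); rewrite -ball_normE/= => /ltW h.
  by rewrite ler_pXn2r ?nnegrE ?(ltW e0)//.
have [p0 p0l] := @filter_ex _ _ FF _ (near_l 1 ltr01).
have p0lS : (fun k => p0 k - l k) \in @square_summable R I.
  by apply/square_summableP; exists (1 ^+ 2).
pose L : ell2 := p0 - Ell2 p0lS.
have LE k : L k = l k by rewrite ell2B/= opprB addrC subrK.
apply/cvg_ex; exists L; apply/cvgrPdist_le => e e0 /=.
apply: filterS (near_l e e0) => p hp; rewrite distrC.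
rewrite -(@ler_pXn2r _ 2) ?nnegrE ?(ltW e0)//; apply: sqr_norm_ell2_le => J.
apply: le_trans (hp J); rewrite !partial_sumE; apply: ler_sum => k _.
by rewrite ell2B LE.
Qed.

HB.instance Definition _ := Uniform_isComplete.Build ell2 ell2_complete.

End ell2_hilbert.

Section prehilbert_theory.
Variables (R : realType) (V : rqPreHilbertType R).
Implicit Types x y z : V.

Lemma rscaler0 x : x *q 0 = 0.
Proof. by apply: (addrI (x *q 0)); rewrite -rscaleDr !addr0. Qed.

Lemma rscalerN x (a : quat R) : x *q (- a) = - (x *q a).
Proof. by apply: (addrI (x *q a)); rewrite -rscaleDr !subrr rscaler0. Qed.

Lemma qdot0r x : qdot x 0 = 0.
Proof. by apply: (addrI (qdot x 0)); rewrite -qdotDr !addr0. Qed.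

Lemma qdotNr x y : qdot x (- y) = - qdot x y.
Proof. by apply: (addrI (qdot x y)); rewrite -qdotDr !subrr qdot0r. Qed.

Lemma qdotBr x y z : qdot x (y - z) = qdot x y - qdot x z.
Proof. by rewrite qdotDr qdotNr. Qed.

Lemma qdotDl x y z : qdot (x + y) z = qdot x z + qdot y z.
Proof. by rewrite -qdotC qdotDr qconjD !qdotC. Qed.

Lemma qdotZl x y (a : quat R) : qdot (x *q a) y = qconj a * qdot x y.
Proof. by rewrite -qdotC qdotZr qconjM qdotC. Qed.

Lemma qdotBl x y z : qdot (x - y) z = qdot x z - qdot y z.
Proof.
rewrite qdotDl; congr (_ + _); apply: (addrI (qdot y z)).
by rewrite -qdotDl !subrr -qdotC qdot0r; congr Quat; rewrite oppr0.
Qed.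

Lemma sqr_norm_qdot x : `|x| ^+ 2 = qre (qdot x x).
Proof.
rewrite norm_qdot sqr_sqrtr//.
by have [->|/qdot_gt0/ltW//] := eqVneq x 0; rewrite qdot0r.
Qed.

Lemma qdotxx x : qdot x x = qreal (`|x| ^+ 2).
Proof.
rewrite sqr_norm_qdot; have := qdotC x x; case: (qdot x x) => a b c d.
by rewrite /qconj/= => -[hb hc hd]; congr Quat; lra.
Qed.

Lemma norm_rscale x (a : quat R) : `|x *q a| = `|x| * `|a|.
Proof.
apply: (pexpIrn (n := 2)); rewrite ?nnegrE ?mulr_ge0//.
rewrite exprMn sqr_norm_qdot qdotZr qdotZl qdotxx sqr_normq.
rewrite -[qconj a * _]/(qmul _ _) -[qmul _ _ * a]/(qmul _ _) /qmul/=.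
ring.
Qed.

Lemma sqr_normD x y :
  `|x + y| ^+ 2 = `|x| ^+ 2 + 2 * qre (qdot x y) + `|y| ^+ 2.
Proof.
rewrite !sqr_norm_qdot qdotDr !qdotDl /=.
rewrite [qre (qdot y x)](_ : _ = qre (qdot x y)); first by ring.
by rewrite -qdotC.
Qed.

Lemma sqr_normB x y :
  `|x - y| ^+ 2 = `|x| ^+ 2 - 2 * qre (qdot x y) + `|y| ^+ 2.
Proof. by rewrite sqr_normD normrN qdotNr /= mulrN. Qed.

Lemma parallelogram x y :
  `|x - y| ^+ 2 = 2 * `|x| ^+ 2 + 2 * `|y| ^+ 2 - `|x + y| ^+ 2.
Proof. by rewrite sqr_normB (sqr_normD x y); ring. Qed.

Lemma qre_qdot_le x y : qre (qdot x y) <= `|x| * `|y|.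
Proof.
have := lerXn2r 2 (normr_ge0 (x + y)) _ (ler_normD x y).
rewrite nnegrE addr_ge0// sqr_normD => /(_ isT).
by rewrite sqrrD; lra.
Qed.

Lemma norm_qdot_le x y : `|qdot x y| <= `|x| * `|y|.
Proof.
have [->|a0] := eqVneq (qdot x y) 0; first by rewrite normr0 mulr_ge0.
have := qre_qdot_le x (y *q qconj (qdot x y)).
rewrite qdotZr norm_rscale normq_conj mulrA.
rewrite -[X in X * qconj _]qconjK qre_conjM -sqr_normq normq_conj expr2.
by rewrite ler_pM2r// normr_gt0.
Qed.

Lemma qdot_injr y z : (forall x, qdot x y = qdot x z) -> y = z.
Proof.
move=> h; apply/eqP; rewrite -subr_eq0; apply/negPn/negP => /qdot_gt0.
by rewrite qdotBr h subrr ltxx.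
Qed.

End prehilbert_theory.

Definition right_linear (R : realType) (U V : rqModType R) (T : U -> V) : Prop :=
  forall (x y : U) (p q : quat R), T (x *q p + y *q q) = T x *q p + T y *q q.

Definition bounded_operator (R : realType) (U V : rqPreHilbertType R)
    (T : U -> V) : Prop :=
  right_linear T /\ exists M : R, forall x, `|T x| <= M * `|x|.

(* Extended-real valued: +oo for an unbounded operator. *)
Definition opnorm (R : realType) (U V : rqPreHilbertType R) (T : U -> V) : \bar R :=
  ereal_sup [set (`|T x|)%:E | x in [set x | `|x| <= 1]].

(* The default value is never used for a bounded operator on a Hilbert space, by
   [adjointP] below, nor for the synthesis operator of a Bessel sequence, by
   [adjoint_synthesis]. *)
Definition adjoint (R : realType) (U V : rqPreHilbertType R) (T : U -> V) : V -> U :=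
  xget (fun=> 0) [set S : V -> U | forall x y, qdot (T x) y = qdot x (S y)].

(* For [M] a closed right subspace, see [orthogonal_projectionP]. *)
Definition orthogonal_projection (R : realType) (V : rqPreHilbertType R)
    (M : set V) (x : V) : V :=
  xget 0 [set p | M p /\ forall m, M m -> qdot m (x - p) = 0].

Definition separable_space (T : topologicalType) : Prop :=
  exists D : set T, countable D /\ dense D.

Section right_linear_theory.
Variables (R : realType) (U V : rqPreHilbertType R) (T : U -> V).
Hypothesis Tlin : right_linear T.

Lemma right_linearD x y : T (x + y) = T x + T y.
Proof. by have := Tlin x y 1 1; rewrite !rscaler1. Qed.

Lemma right_linearZ x (a : quat R) : T (x *q a) = T x *q a.
Proof. by have := Tlin x x a 0; rewrite !rscaler0 !addr0. Qed.

Lemma right_linearB x y : T (x - y) = T x - T y.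
Proof. by have := Tlin x y 1 (- 1); rewrite !rscalerN !rscaler1. Qed.

Lemma right_linear0 : T 0 = 0.
Proof. by rewrite -(subrr 0) right_linearB subrr. Qed.

End right_linear_theory.

Section projection.
Variables (R : realType) (V : rqHilbertType R) (M : set V).
Hypothesis Mlin : forall x y (p q : quat R), M x -> M y -> M (x *q p + y *q q).
Hypothesis M0 : M 0.
Hypothesis Mclosed : closed M.

Let MB x y : M x -> M y -> M (x - y).
Proof.
by move=> Mx My; have := Mlin 1 (- 1) Mx My; rewrite rscalerN !rscaler1.
Qed.

Let MD x y : M x -> M y -> M (x + y).
Proof. by move=> Mx My; have := Mlin 1 1 Mx My; rewrite !rscaler1. Qed.

Let MZ x (a : quat R) : M x -> M (x *q a).
Proof. by move=> Mx; have := Mlin a 0 Mx Mx; rewrite rscaler0 addr0. Qed.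

Let MZr x (t : R) : M x -> M (t *: x).
Proof. by rewrite scale_rscale; exact: MZ. Qed.

Lemma orthogonal_projection_exists x :
  exists p, M p /\ forall m, M m -> qdot m (x - p) = 0.
Proof.
pose D := [set `|x - m| ^+ 2 | m in M].
have D0 : lbound D 0 by move=> _ [m _ <-]; exact: sqr_ge0.
have infD : has_inf D by split; [exists (`|x - 0| ^+ 2), 0|exists 0].
pose d := inf D.
have dle m : M m -> d <= `|x - m| ^+ 2.
  by move=> Mm; apply: ge_inf; [case: infD|exists m].
pose B e := [set m | M m /\ `|x - m| ^+ 2 < d + e].
pose F : set_system V := filter_from [set e : R | 0 < e] B.
have FF : ProperFilter F.
  apply: filter_from_proper; last first.
    move=> e e0; have [_ [m Mm <-] hm] := inf_adherent e0 infD.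
    by exists m.
  apply: filter_from_filter; first by exists 1 => /=.
  move=> e1 e2 e10 e20; exists (Num.min e1 e2); first by rewrite /= lt_min e10.
  move=> m [Mm]; rewrite -ltrBlDl lt_min => /andP[h1 h2].
  by split; split=> //; rewrite -ltrBlDl.
have close e m n : B e m -> B e n -> `|m - n| ^+ 2 < 4 * e.
  move=> [Mm hm] [Mn hn].
  have := dle (2^-1 *: (m + n)) (MZr _ (MD Mm Mn)).
  have -> : x - 2^-1 *: (m + n) = 2^-1 *: ((x - m) + (x - n)).
    rewrite addrACA -opprD scalerBr -mulr2n -[x *+ 2]scaler_nat.
    by rewrite scalerA mulVf// scale1r.
  have -> : m - n = (x - n) - (x - m) by rewrite opprB [RHS]addrC addrA subrK.
  rewrite normrZ exprMn ger0_norm// distrC parallelogram => hd.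
  by rewrite [2^-1 ^+ 2](_ : _ = 4^-1) in hd; [lra|field].
have /cvg_ex[p Fp] : cvg F.
  apply: cauchy_cvg; apply/cauchy_ballP => e e0.
  have e20 : 0 < e ^+ 2 / 4 by rewrite divr_gt0// exprn_gt0.
  exists (B (e ^+ 2 / 4), B (e ^+ 2 / 4)) => /=.
    by split; exists (e ^+ 2 / 4).
  move=> [m n] /= [Bm Bn]; rewrite -ball_normE/= -(@ltr_pXn2r _ 2) ?nnegrE ?(ltW e0)//.
  by apply: lt_le_trans (close _ _ _ Bm Bn) _; rewrite mulrC divfK.
have Mp : M p.
  apply: (@closed_cvg _ _ F _ id M Mclosed _ p Fp).
  by exists 1 => //= m [].
have pd : `|x - p| ^+ 2 = d.
  apply/eqP; rewrite eq_le dle// andbT; apply/ler_addgt0Pr => e e0.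
  have cp : (fun m => `|x - m| ^+ 2) @ F --> `|x - p| ^+ 2.
    under eq_fun do rewrite expr2; rewrite expr2.
    by apply: cvgM; apply: cvg_norm; apply: cvgB => //; exact: cvg_cst.
  by apply: (cvgr_to_le cp); exists e => //= m [_ /ltW].
exists p; split=> //.
have re0 m : M m -> qre (qdot m (x - p)) = 0.
  move=> Mm; suff : qre (qdot (x - p) m) ^+ 2 <= 0.
    by rewrite -qdotC/= => h; apply/eqP; rewrite -sqrf_eq0 eq_le h sqr_ge0.
  rewrite -[leRHS](mulr0 (`|m| ^+ 2)); apply: discriminant_le.
    exact: sqr_ge0.
  move=> t; have := dle (p - t *: m) (MB Mp (MZr _ Mm)).
  have -> : x - (p - t *: m) = (x - p) + t *: m by rewrite opprB addrA addrAC.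
  rewrite sqr_normD pd normrZ exprMn real_normK ?num_real//.
  rewrite scale_rscale qdotZr qre_mulqreal; lra.
move=> m Mm; apply/eqP; rewrite -normr_eq0 -sqrf_eq0 sqr_normq -qre_conjM.
by rewrite -qdotZl re0//; exact: MZ.
Qed.

Lemma orthogonal_projectionP x :
  M (orthogonal_projection M x) /\
  forall m, M m -> qdot m (x - orthogonal_projection M x) = 0.
Proof.
rewrite /orthogonal_projection; case: xgetP => [p _ //|h].
by have [p /h] := orthogonal_projection_exists x.
Qed.

End projection.

Section adjoint_theory.
Variables (R : realType) (U : rqHilbertType R) (V : rqPreHilbertType R).

Lemma bounded_operator_continuous (W : rqPreHilbertType R) (T : U -> W) :
  bounded_operator T -> continuous T.
Proof.
move=> [Tlin [C TC]] x; apply: (cvg_lipschitz (C := C) (g := id)) => // y z.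
by rewrite -(right_linearB Tlin).
Qed.

Lemma qinv_exists (b : quat R) : b != 0 -> exists c, b * c = 1.
Proof.
move=> b0; have : `|b| ^+ 2 != 0 by rewrite sqrf_eq0 normr_eq0.
rewrite sqr_normq; case: b {b0} => a b c d /=.
set n := _ + _ => n0; exists (Quat (a / n) (- b / n) (- c / n) (- d / n)).
by rewrite -[LHS]/(qmul _ _) /qmul/=; congr Quat; rewrite /n; field.
Qed.

Lemma riesz (phi : U -> quat R) : bounded_operator phi ->
  exists z, forall x, phi x = qdot z x.
Proof.
move=> phib; have [phil [C phiC]] := phib.
have [phi0|] := pselect (forall x, phi x = 0).
  by exists 0 => x; rewrite phi0 -qdotC qdot0r; congr Quat; rewrite oppr0.
move=> /existsNP[x0 /eqP phix0].
pose M := [set x | phi x = 0].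
have Mlin x y (p q : quat R) : M x -> M y -> M (x *q p + y *q q).
  by rewrite /M/= phil => -> ->; rewrite -[_ *q p]/(0 * p) -[_ *q q]/(0 * q) !mul0r addr0.
have M0 : M 0 by exact: right_linear0.
have Mcl : closed M.
  apply: (@preimage_closed _ _ phi [set 0]).
    by move=> x _; exact: bounded_operator_continuous.
  exact/accessible_closed_set1/hausdorff_accessible/norm_hausdorff.
have [] := orthogonal_projectionP Mlin M0 Mcl x0.
set p := orthogonal_projection M x0; rewrite {1}/M/= => phip up.
set u := x0 - p in up; set b := phi u.
have b0 : b != 0 by rewrite /b /u (right_linearB phil) phip subr0.
have [c bc] := qinv_exists b0.
have u0 : `|u| ^+ 2 != 0.
  rewrite sqrf_eq0 normr_eq0; apply: contra b0 => /eqP u0.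
  by rewrite /b u0 (right_linear0 phil).
exists (u *q (qreal (`|u| ^- 2) * qconj b)) => x.
rewrite qdotZl qconjM qconjK.
have : M (x - u *q (c * phi x)).
  rewrite /M/= (right_linearB phil) (right_linearZ phil) -/b.
  by rewrite -[b *q _]/(b * _) mulrA bc mul1r subrr.
move=> /up; rewrite -qdotC qdotBr qdotZr qdotxx => /(congr1 (@qconj R)).
rewrite qconjK [RHS](_ : _ = 0); last by congr Quat; rewrite oppr0.
move=> /eqP; rewrite subr_eq0 => /eqP ->.
rewrite [qconj (qreal _)](_ : _ = qreal (`|u| ^- 2)); last first.
  by congr Quat; rewrite oppr0.
rewrite -mulrA [qreal _ * (qreal _ * _)]mulrA -qrealM mulVf//.
by rewrite -[qreal 1]/(1 : quat R) mul1r mulrA bc mul1r.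
Qed.

Lemma adjointP (T : U -> V) : bounded_operator T ->
  forall x y, qdot (T x) y = qdot x (adjoint T y).
Proof.
move=> [Tlin [C TC]]; rewrite /adjoint; case: xgetP => [S _ //|h].
have [y|S HS] := @choice V U (fun y z => forall x, qdot y (T x) = qdot z x).
  apply: riesz; split.
    by move=> a b p q; rewrite Tlin qdotDr !qdotZr.
  exists (`|y| * C) => x; apply: le_trans (norm_qdot_le _ _) _.
  by rewrite -mulrA ler_wpM2l.
by case: (h S) => x y; rewrite -qdotC HS qdotC.
Qed.

End adjoint_theory.

Lemma adjoint_unique (R : realType) (U V : rqPreHilbertType R) (T : U -> V)
    (S : V -> U) : (forall x y, qdot (T x) y = qdot x (S y)) -> adjoint T = S.
Proof.
rewrite /adjoint => TS; case: xgetP => [S' _ TS'|/(_ S)//].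
by apply/funext => y; apply: qdot_injr => x; rewrite -TS' TS.
Qed.

Section frames.
Variables (R : realType) (I : choiceType) (V : rqHilbertType R).
Implicit Types (K : V -> V) (F G : I -> V).

Definition bessel F : Prop := exists2 B : R, 0 < B &
  forall x, (\esum_(k in [set: I]) (`|qdot x (F k)| ^+ 2)%:E
             <= (B * `|x| ^+ 2)%:E)%E.

Definition K_frame K F : Prop := exists A B : R, [/\ 0 < A, 0 < B &
  forall x, ((A * `|adjoint K x| ^+ 2)%:E
             <= \esum_(k in [set: I]) (`|qdot x (F k)| ^+ 2)%:E
             <= (B * `|x| ^+ 2)%:E)%E].

(* The definition presupposes that F is a K-frame. The series converges
   unconditionally: it is a limit along the finite subsets of I. *)
Definition K_dual K F G : Prop := [/\ K_frame K F, bessel G &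
  forall x, partial_sum (fun k => F k *q qdot (G k) x) @ totally --> K x].

Definition synthesis F (c : ell2 R I) : V := family_sum (fun k => F k *q c k).

Definition approximate_K_dual K F G : Prop := [/\ K_frame K F, bessel G &
  (opnorm (K \- (synthesis F \o adjoint (synthesis G)))%R < 1)%E].

Lemma bessel_partial_sum F : bessel F -> exists2 B : R, 0 < B &
  forall x J, partial_sum (fun k => `|qdot x (F k)| ^+ 2) J <= B * `|x| ^+ 2.
Proof.
move=> [B B0 FB]; exists B => // x J; rewrite -lee_fin.
apply: le_trans (FB x); apply: ereal_sup_ubound; exists [set` J] => //.
by rewrite fsbig_finite//= set_fsetK sumEFin partial_sumE.
Qed.

Lemma bessel_synthesis_cvg F (c : ell2 R I) : bessel F ->
  partial_sum (fun k => F k *q c k) @ totally --> synthesis F c.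
Proof.
move=> /bessel_partial_sum[B B0 FB].
have key J : `|partial_sum (fun k => F k *q c k) J| ^+ 2 <=
    B * partial_sum (fun k => `|c k| ^+ 2) J.
  set s := partial_sum _ J.
  have : `|s| ^+ 2 <= (2 * B)^-1 * partial_sum (fun k => `|qdot s (F k)| ^+ 2) J
      + B / 2 * partial_sum (fun k => `|c k| ^+ 2) J.
    rewrite sqr_norm_qdot {2}/s !partial_sumE !mulr_sumr -big_split/=.
    rewrite (big_morph (qdot s) (id1 := 0) (op1 := +%R)) ?qdot0r//; last first.
      exact: qdotDr.
    rewrite (big_morph (@qre R) (id1 := 0) (op1 := +%R))//.
    apply: ler_sum => k _; rewrite qdotZr.
    have [+ _ _ _] := quat_comp_le (qdot s (F k) * c k).
    rewrite normqM => /(le_trans (ler_norm _))/le_trans; apply.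
    rewrite -subr_ge0 [leRHS](_ : _ =
      (2 * B)^-1 * (`|qdot s (F k)| - B * `|c k|) ^+ 2).
      by rewrite mulr_ge0 ?sqr_ge0// invr_ge0 mulr_ge0// ltW.
    by field; rewrite gt_eqF.
  have := FB s J; set u := partial_sum _ J; set v := partial_sum _ J.
  move=> hu; have : (2 * B)^-1 * u <= `|s| ^+ 2 / 2.
    rewrite mulrC ler_pdivrMr ?mulr_gt0//; apply: le_trans hu _.
    by rewrite le_eqVlt; apply/orP; left; apply/eqP; field.
  by lra.
have /square_summableP[M cM] := ell2_square_summable c.
apply: (@cvg_family_sum _ _ V _ (fun k => B * `|c k| ^+ 2) 2 (B * M)) => //.
- by move=> k; rewrite mulr_ge0 ?sqr_ge0// ltW.
- by move=> J; apply: le_trans (key J) _; rewrite !partial_sumE mulr_sumr.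
- move=> J; rewrite [leLHS](_ : _ = B * partial_sum (fun k => `|c k| ^+ 2) J).
    by rewrite ler_wpM2l// ltW.
  by rewrite !partial_sumE mulr_sumr.
Qed.

Lemma adjoint_synthesis F (x : V) k : bessel F ->
  adjoint (synthesis F) x k = qdot (F k) x.
Proof.
move=> FB; have [B B0 FBx] := bessel_partial_sum FB.
have Fx2 z : (fun k => qdot (F k) z) \in @square_summable R I.
  apply/square_summableP; exists (B * `|z| ^+ 2) => J.
  apply: le_trans (FBx z J); rewrite !partial_sumE; apply: ler_sum => i _.
  by rewrite -(normq_conj (qdot _ _)) qdotC.
rewrite (@adjoint_unique _ _ _ _ (fun z => Ell2 (Fx2 z)))// => c z.
apply/esym/ell2_dot_unique.
rewrite [X in X @ _ --> _](_ : _ = (fun y => qdot y z) \o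
    partial_sum (fun k => F k *q c k)).
  apply: (cvg_lipschitz (C := `|z|)) (@bessel_synthesis_cvg F c FB) => a b.
  by rewrite -qdotBl mulrC norm_qdot_le.
apply/funext => J /=; rewrite !partial_sumE.
rewrite (big_morph (fun y => qdot y z) (id1 := 0) (op1 := +%R)).
- by apply: eq_bigr => i _; rewrite qdotZl.
- by move=> a b; rewrite qdotDl.
- by rewrite -(subrr (0 : V)) qdotBl subrr.
Qed.

End frames.

(* Main.v *)
Require Import Defs.
From mathcomp Require Import all_boot all_order all_algebra.
From mathcomp Require Import all_classical all_reals.
From mathcomp Require Import ereal topology normedtype.

Import Order.TTheory GRing.Theory Num.Theory.
Import numFieldNormedType.Exports.

(** Write [P] for the projection onto the range of [K], and [S = T_F T_G^*].
    Since [G] is a K-dual of [P F], we have [P S = K], so [S - K = (1 - P) S]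
    is bounded pointwise by [S], whence [||K - S|| <= ||S|| < 1]. *)

Section Lemmas.
Local Set Implicit Arguments.
Local Unset Strict Implicit.
Local Open Scope classical_set_scope.
Local Open Scope ring_scope.

Lemma K_frame_bessel (R : realType) (I : choiceType) (V : rqHilbertType R)
    (K : V -> V) (F : I -> V) : K_frame K F -> bessel F.
Proof. by move=> [A [B [_ B0 FB]]]; exists B => // x; have /andP[] := FB x. Qed.

(** By Cauchy-Schwarz, [qdot m] is Lipschitz with constant [|m|], so orthogonality to [m] survives
    limits. *)
Lemma qdot_cvg_eq0 (R : realType) (V : rqPreHilbertType R) (T : Type)
    (A : set_system T) {AA : ProperFilter A} (m : V) (u : T -> V) (l : V) :
  (forall t, qdot m (u t) = 0) -> u @ A --> l -> qdot m l = 0.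
Proof.
move=> u0 /(cvg_lipschitz (C := `|m|) (f := qdot m)) h.
have /h : forall x y, `|qdot m x - qdot m y| <= `|m| * `|x - y|.
  by move=> x y; rewrite -qdotBr norm_qdot_le.
rewrite (_ : qdot m \o u = cst 0); last exact/funext.
by move=> /norm_cvg_lim <-; rewrite lim_cst//; exact: norm_hausdorff.
Qed.

(** Pythagoras for the orthogonal decomposition [x = y + (x - y)]. *)
Lemma norm_residual_le (R : realType) (V : rqPreHilbertType R) (x y : V) :
  qdot y (x - y) = 0 -> `|y - x| <= `|x|.
Proof.
move=> yx; rewrite distrC -(@ler_pXn2r _ 2) ?nnegrE//.
have -> : `|x| ^+ 2 = `|y + (x - y)| ^+ 2 by rewrite addrC subrK.
by rewrite sqr_normD yx mulr0 addr0 lerDr sqr_ge0.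
Qed.

Lemma opnorm_le (R : realType) (U V : rqPreHilbertType R) (S T : U -> V) :
  (forall x, `|S x| <= `|T x|) -> (opnorm S <= opnorm T)%E.
Proof.
move=> ST; apply: ge_ereal_sup => _ [x x1 <-].
apply: (@le_trans _ _ (`|T x|)%:E); first by rewrite lee_fin.
by apply: ereal_sup_ubound; exists x.
Qed.

(** The residual is the limit of finite sums of [(F k - P k) *q qdot (G k) x], each term orthogonal
    to [m]. In the theorem, [P] is the projected family. *)
Lemma qdot_synthesis_residual (R : realType) (I : choiceType)
    (V : rqHilbertType R) (K : V -> V) (F P G : I -> V) (m x : V) :
  bessel F -> K_dual K P G -> (forall k, qdot m (F k - P k) = 0) ->
  qdot m (synthesis F (adjoint (synthesis G) x) - K x) = 0.
Proof.
move=> Fb [_ Gb PG] mFP.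
(* Both series converge along the same filter of finite subsets, so they can be subtracted
   termwise. *)
have SK := cvgB (bessel_synthesis_cvg (c := adjoint (synthesis G) x) Fb) (PG x).
apply: (qdot_cvg_eq0 _ (SK _)) => J.
rewrite !fctE !partial_sumE -sumrB.
rewrite (big_morph (qdot m) (id1 := 0) (op1 := +%R)) ?qdot0r//; last exact: qdotDr.
apply: big1 => k _; rewrite adjoint_synthesis//.
by rewrite qdotBr !qdotZr -mulrBl -qdotBr mFP mul0r.
Qed.

End Lemmas.

Theorem theorem4p4 (R : realType) (I : countType) (V : rqHilbertType R)
    (K : V -> V) (F G : I -> V)
    (V_separable : separable_space V)
    (K_bounded : bounded_operator K)
    (K_closed_range : closed (range K))
    (F_frame : K_frame K F)
    (G_dual : K_dual K (fun k => orthogonal_projection (range K) (F k)) G)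
    (TFTG_lt1 : (opnorm (synthesis F \o adjoint (synthesis G)) < 1)%E) :
  approximate_K_dual K F G.
Proof.
have [Klin _] := K_bounded; have Fb := K_frame_bessel F_frame.
split=> //; first by case: G_dual.
apply: le_lt_trans TFTG_lt1; apply: opnorm_le => x /=.
(* It suffices that [K x] is orthogonal to [S x - K x]: take [m := K x]. *)
apply: norm_residual_le; apply: qdot_synthesis_residual Fb G_dual _ => k.
have [||//|_] := orthogonal_projectionP (M := range K) _ _ _ (F k).
- by move=> _ _ p q [a _ <-] [b _ <-]; exists (a *q p + b *q q)%R.
- by exists 0%R => //; exact: right_linear0.
(* [K x] lies in the range of [K], to which [F k] minus its projection is orthogonal. *)
- by apply; exists x.
Qed.
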